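(* Let $D$ be an integral domain. Then the assignments $R\mapsto\mathrm{LPic}(R,D)$ and $R\mapsto\mathrm{LPic}_u(R,D)$ give rise to (covariant) functors from the category of $D$-algebras that are integral domains (for $\mathrm{LPic}_u$: that are moreover extensions of $D$), with $D$-algebra homomorphisms as morphisms, to the category of abelian groups, where a morphism $\phi:R\to R'$ is sent to the homomorphism induced by the map $\mathrm{Pic}(\phi):\mathrm{Pic}(R)\to\mathrm{Pic}(R')$.
   Context: All rings are commutative with unit; $D$ is an integral domain that is not a field, with quotient field $K$. $\mathrm{Pic}(R)$ is the group of invertible fractional ideals of the domain $R$ modulo nonzero principal fractional ideals, equivalently the group of isomorphism classes of rank-one projective $R$-modules under $\otimes$; it is functorial in $R$ (a homomorphism $\phi:R\to R'$ induces $[P]\mapsto[P\otimes_RR']$). With $\iota:\mathrm{Pic}(D)\to\mathrm{Pic}(R)$ the canonical map, the local Picard group is $\mathrm{LPic}(R,D):=\mathrm{Pic}(R)/\iota(\mathrm{Pic}(D))$. If $R$ is an extension of $D$ (with $K$ viewed inside the quotient field of $R$), a fractional ideal $I$ of $R$ is integral if $I\subseteq R$, and unitary with respect to $D$ if $I\cap K\neq(0)$; $\mathrm{Pic}_u(R,D)$ is the subgroup of $\mathrm{Pic}(R)$ generated by the classes of the invertible ideals of $R$ that are both integral and unitary with respect to $D$. It contains $\iota(\mathrm{Pic}(D))$, and $\mathrm{LPic}_u(R,D):=\mathrm{Pic}_u(R,D)/\iota(\mathrm{Pic}(D))$. *)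

(* Defs.v *)
From HB Require Import structures.
From mathcomp Require Import all_boot all_order all_algebra.
From mathcomp Require Import boolp classical_sets.
Set Implicit Arguments.
Unset Strict Implicit.
Unset Printing Implicit Defensive.
Import GRing.Theory.
Local Open Scope classical_set_scope.
Local Open Scope quotient_scope.
Local Open Scope ring_scope.

Notation "x %:F" := (@FracField.tofrac _ x).

Section FractionalIdeals.
Variable R : idomainType.
Local Notation K := {fraction R}.
Implicit Types (I J L : set K) (x y z : K).

Definition is_submod I :=
  [/\ I 0, forall x y, I x -> I y -> I (x + y) & forall (r : R) x, I x -> I (r%:F * x)].

Definition fractional I :=
  is_submod I /\
  exists2 d : R, d != 0 & forall x, I x -> exists r : R, d%:F * x = r%:F.

Definition prod_ideal I J : set K :=
  [set z | exists2 s : seq (K * K),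
      forall p, p \in s -> I p.1 /\ J p.2 & z = \sum_(p <- s) p.1 * p.2].

Definition unit_ideal : set K := [set x | exists r : R, x = r%:F].

Definition principal_ideal (x : K) : set K := [set y | exists r : R, y = r%:F * x].

Definition invertible I :=
  fractional I /\ exists2 J, fractional J & prod_ideal I J = unit_ideal.

Definition integral I := I `<=` unit_ideal.

Lemma submod_sum I (T : eqType) (s : seq T) (F : T -> K) : is_submod I ->
  (forall p, p \in s -> I (F p)) -> I (\sum_(p <- s) F p).
Proof.
move=> [I0 ID _]; elim: s => [|p s IH] h; first by rewrite big_nil.
by rewrite big_cons; apply: ID; [apply: h; rewrite mem_head | apply: IH => q qs; apply: h; rewrite inE qs orbT].
Qed.

Lemma prod_sub I J L : is_submod L ->
  (forall x y, I x -> J y -> L (x * y)) -> prod_ideal I J `<=` L.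
Proof.
move=> sL h z [s hs ->]; apply: submod_sum => // p /hs [? ?]; exact: h.
Qed.

Lemma prod_in I J x y : I x -> J y -> prod_ideal I J (x * y).
Proof.
move=> Ix Jy; exists [:: (x, y)]; last by rewrite big_seq1.
by move=> p; rewrite inE => /eqP ->.
Qed.

Lemma prod_submod I J : is_submod I -> is_submod (prod_ideal I J).
Proof.
move=> [I0 ID IM]; split.
- by exists [::]; rewrite ?big_nil.
- move=> x y [s hs ->] [t ht ->]; exists (s ++ t); last by rewrite big_cat.
  by move=> p; rewrite mem_cat => /orP[/hs|/ht].
- move=> r x [s hs ->]; exists [seq (r%:F * p.1, p.2) | p <- s].
    by move=> p /mapP[q /hs [? ?] ->]; split => //; apply: IM.
  rewrite big_map mulr_sumr; apply: eq_bigr => p _; exact: mulrA.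
Qed.

Lemma prodC I J : prod_ideal I J = prod_ideal J I.
Proof.
by apply/seteqP; split=> z [s hs ->]; exists [seq (p.2, p.1) | p <- s];
  rewrite ?big_map; try (by apply: eq_bigr => p _; exact: mulrC);
  move=> p /mapP[q /hs [? ?] ->].
Qed.

Lemma prodA I J L : is_submod I -> is_submod J -> is_submod L ->
  prod_ideal I (prod_ideal J L) = prod_ideal (prod_ideal I J) L.
Proof.
move=> sI sJ sL; apply/seteqP; split; apply: prod_sub.
- by do 2!apply: prod_submod.
- move=> x _ Ix [s hs ->]; rewrite mulr_sumr.
  apply: submod_sum; first by do 2!apply: prod_submod.
  by move=> p /hs [? ?]; rewrite mulrA; do 2!apply: prod_in => //.
- exact: prod_submod.
- move=> _ x [s hs ->] Lx; rewrite mulr_suml.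
  apply: submod_sum; first exact: prod_submod.
  by move=> p /hs [? ?]; rewrite -mulrA; do 2!apply: prod_in => //.
Qed.

Lemma unit_submod : is_submod unit_ideal.
Proof.
split; first by exists 0; rewrite rmorph0.
- by move=> _ _ [a ->] [b ->]; exists (a + b); rewrite rmorphD.
- by move=> r _ [a ->]; exists (r * a); rewrite rmorphM.
Qed.

Lemma unit_fractional : fractional unit_ideal.
Proof.
split; first exact: unit_submod.
by exists 1; rewrite ?oner_neq0 // => _ [r ->]; exists r; rewrite rmorph1 mul1r.
Qed.

Lemma principal_submod x : is_submod (principal_ideal x).
Proof.
split; first by exists 0; rewrite rmorph0 mul0r.
- by move=> _ _ [a ->] [b ->]; exists (a + b); rewrite rmorphD mulrDl.
- by move=> r _ [a ->]; exists (r * a); rewrite rmorphM mulrA.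
Qed.

Lemma fracP x : exists a b : R, b != 0 /\ x = a%:F / b%:F.
Proof.
elim/quotW: x => q; exists (frac q).1, (frac q).2; split; first exact: denom_ratioP.
have bn := denom_ratioP q.
have bF : (frac q).2%:F != 0 :> K by rewrite tofrac_eq0.
apply: (mulIf bF); rewrite mulfVK //; unlock FracField.tofrac.
apply/eqP; rewrite [_ * _]piE.
rewrite eqmodE /= FracField.equivfE.
rewrite !numden_Ratio ?oner_neq0 ?mulr1 ?mul1r //.
by rewrite mulrC.
Qed.

Lemma principal_fractional x : fractional (principal_ideal x).
Proof.
split; first exact: principal_submod.
have [a [b [bn ->]]] := fracP x; exists b => // _ [r ->]; exists (r * a).
have bF : b%:F != 0 :> K by rewrite tofrac_eq0.
by rewrite rmorphM /= mulrC -!mulrA mulVf // mulr1.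
Qed.

Lemma prod1 I : is_submod I -> prod_ideal unit_ideal I = I.
Proof.
move=> sI; apply/seteqP; split.
  by apply: prod_sub => // _ x [r ->]; case: sI => _ _; apply.
by move=> x Ix; rewrite -[x]mul1r; apply: prod_in => //; exists 1; rewrite rmorph1.
Qed.

Lemma prod_principal x y :
  prod_ideal (principal_ideal x) (principal_ideal y) = principal_ideal (x * y).
Proof.
apply/seteqP; split.
  apply: prod_sub; first exact: principal_submod.
  by move=> _ _ [a ->] [b ->]; exists (a * b); rewrite rmorphM mulrACA.
move=> _ [r ->]; rewrite mulrA; apply: prod_in; first by exists r.
by exists 1; rewrite rmorph1 mul1r.
Qed.

Lemma principal1 : principal_ideal 1 = unit_ideal.
Proof. by apply/seteqP; split=> _ [r ->]; exists r; rewrite mulr1. Qed.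

Lemma prod_fractional I J : fractional I -> fractional J ->
  fractional (prod_ideal I J).
Proof.
move=> [sI [d dn hd]] [sJ [e en he]]; split; first exact: prod_submod.
exists (d * e); first by rewrite mulf_neq0.
move=> _ [s hs ->]; rewrite mulr_sumr.
apply: (submod_sum unit_submod) => p /hs[/hd [a Ha] /he [b Hb]].
by exists (a * b); rewrite !rmorphM mulrACA Ha Hb.
Qed.

Lemma invertibleM I J : invertible I -> invertible J ->
  invertible (prod_ideal I J).
Proof.
move=> [fI [I' fI' eI]] [fJ [J' fJ' eJ]]; split; first exact: prod_fractional.
exists (prod_ideal I' J'); first exact: prod_fractional.
have [sI [sI' [sJ sJ']]] := (fI.1, (fI'.1, (fJ.1, fJ'.1))).
rewrite -(prodA sI sJ (prod_submod _ sI')).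
rewrite [prod_ideal J _]prodA // [prod_ideal J I']prodC -[prod_ideal _ J']prodA //.
by rewrite eJ [prod_ideal I' _]prodC prod1.
Qed.

Lemma invertible1 : invertible unit_ideal.
Proof.
split; first exact: unit_fractional.
by exists unit_ideal; [exact: unit_fractional | rewrite prod1 //; exact: unit_submod].
Qed.

Lemma invertible_of_principal I J x : x != 0 -> fractional I -> fractional J ->
  prod_ideal I J = principal_ideal x -> invertible I.
Proof.
move=> xn fI fJ e; split => //.
exists (prod_ideal J (principal_ideal x^-1)).
  by apply: prod_fractional => //; apply: principal_fractional.
rewrite prodA ?e ?prod_principal ?mulfV ?principal1 //; [exact: fI.1|exact: fJ.1|].
exact: principal_submod.
Qed.

Lemma principal_invertible x : x != 0 -> invertible (principal_ideal x).
Proof.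
move=> xn; apply: (@invertible_of_principal _ unit_ideal x) => //.
- exact: principal_fractional.
- exact: unit_fractional.
- by rewrite prodC prod1 //; exact: principal_submod.
Qed.

(** Abelian groups are [zmodType]s, so the group law below, multiplication of
    ideals, is written additively, and so is that of [Pic]. *)
Record inv_ideal := InvIdeal {
  carrier :> set K;
  inv_idealP : invertible carrier }.

Lemma inv_ideal_inj (I J : inv_ideal) : carrier I = carrier J -> I = J.
Proof.
by case: I J => [I hI] [J hJ] /= e; subst J; congr InvIdeal; exact: Prop_irrelevance.
Qed.

HB.instance Definition _ := gen_eqMixin inv_ideal.
HB.instance Definition _ := gen_choiceMixin inv_ideal.

Lemma inv_ideal_submod (I : inv_ideal) : is_submod I.
Proof. by case: I => I [[]]. Qed.
Hint Resolve inv_ideal_submod : core.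

Definition mul_inv_ideal (I J : inv_ideal) :=
  InvIdeal (invertibleM (inv_idealP I) (inv_idealP J)).

Definition one_inv_ideal := InvIdeal invertible1.

Lemma inv_ideal_inverse (I : inv_ideal) :
  exists J : inv_ideal, mul_inv_ideal J I = one_inv_ideal.
Proof.
have [fI [J fJ e]] := inv_idealP I.
have iJ : invertible J by split => //; exists I; rewrite // prodC.
by exists (InvIdeal iJ); apply: inv_ideal_inj; rewrite /= prodC.
Qed.

Definition opp_inv_ideal (I : inv_ideal) := projT1 (cid (inv_ideal_inverse I)).

Lemma mul_inv_idealA : associative mul_inv_ideal.
Proof. by move=> I J L; apply: inv_ideal_inj; rewrite /= prodA. Qed.
Lemma mul_inv_idealC : commutative mul_inv_ideal.
Proof. by move=> I J; apply: inv_ideal_inj; rewrite /= prodC. Qed.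
Lemma mul_inv_ideal1 : left_id one_inv_ideal mul_inv_ideal.
Proof. by move=> I; apply: inv_ideal_inj; rewrite /= prod1. Qed.
Lemma mul_inv_idealV : left_inverse one_inv_ideal opp_inv_ideal mul_inv_ideal.
Proof. by move=> I; rewrite /opp_inv_ideal; case: cid. Qed.

HB.instance Definition _ := GRing.isZmodule.Build inv_ideal
  mul_inv_idealA mul_inv_idealC mul_inv_ideal1 mul_inv_idealV.

Lemma inv_idealD (I J : inv_ideal) : (I + J : inv_ideal) = prod_ideal I J :> set K.
Proof. by []. Qed.
Lemma inv_ideal0 : (0 : inv_ideal) = unit_ideal :> set K.
Proof. by []. Qed.

Definition is_principal : {pred inv_ideal} :=
  fun I : inv_ideal => `[< exists2 x : K, x != 0 & I = principal_ideal x :> set K >].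

Lemma is_principal_closed : zmod_closed is_principal.
Proof.
split=> [|I J /asboolP[x xn ex] /asboolP[y yn ey]]; apply/asboolP.
  by exists 1; rewrite ?oner_neq0 ?principal1.
exists (x / y); first by rewrite mulf_neq0 ?invr_eq0.
have -> : J = InvIdeal (principal_invertible yn) by apply: inv_ideal_inj.
have -> : I = InvIdeal (principal_invertible xn) by apply: inv_ideal_inj.
set Iy := InvIdeal (principal_invertible yn).
have yVn : y^-1 != 0 by rewrite invr_eq0.
suff -> : - Iy = InvIdeal (principal_invertible yVn) by exact: prod_principal.
apply: (addrI Iy); rewrite subrr; apply: inv_ideal_inj.
by rewrite inv_idealD /= prod_principal mulfV // principal1.
Qed.
HB.instance Definition _ := GRing.isZmodClosed.Build inv_ideal is_principal
  is_principal_closed.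

Definition Pic := Quotient.quot is_principal.
HB.instance Definition _ := GRing.Zmodule.on Pic.

End FractionalIdeals.

Arguments unit_ideal {R}.
#[global] Hint Resolve inv_ideal_submod unit_submod principal_submod : core.

Definition ideal_class (R : idomainType) (I : inv_ideal R) : Pic R := \pi_(Pic R) I.

(** [N] is [M (x)_R R'], for [R'] an [R]-algebra via [phi]: there is a
    [phi]-semilinear map [M -> N] which is universal among [phi]-semilinear maps
    from [M] to [R']-modules. *)
Definition is_scalar_extension (R R' : comNzRingType) (phi : {rmorphism R -> R'})
    (M : lmodType R) (N : lmodType R') : Prop :=
  exists u : {linear M -> N | phi \; *:%R},
    forall (P : lmodType R') (v : {linear M -> P | phi \; *:%R}),
      exists w : {linear N -> P},
        (w \o u =1 v) /\ (forall w' : {linear N -> P}, w' \o u =1 v -> w' =1 w).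

Section FractionModule.
Variable R : idomainType.

Definition frac_mod := {fraction R}.
HB.instance Definition _ := GRing.Zmodule.on frac_mod.

Definition frac_scale (r : R) (x : frac_mod) : frac_mod := r%:F * (x : {fraction R}).

Fact frac_scaleA r s x : frac_scale r (frac_scale s x) = frac_scale (r * s) x.
Proof. by rewrite /frac_scale mulrA -rmorphM. Qed.
Fact frac_scale1 : left_id 1 frac_scale.
Proof. by move=> x; rewrite /frac_scale rmorph1 mul1r. Qed.
Fact frac_scaleDr : right_distributive frac_scale +%R.
Proof. by move=> r x y; rewrite /frac_scale mulrDr. Qed.
Fact frac_scaleDl x : {morph frac_scale^~ x : r s / r + s}.
Proof. by move=> r s; rewrite /frac_scale rmorphD mulrDl. Qed.
HB.instance Definition _ := GRing.Zmodule_isLmodule.Build R frac_mod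
  frac_scaleA frac_scale1 frac_scaleDr frac_scaleDl.

Lemma frac_scaleE (r : R) (x : frac_mod) : r *: x = r%:F * (x : {fraction R}).
Proof. by []. Qed.

Definition ideal_pred (I : inv_ideal R) : {pred frac_mod} := fun x => `[< carrier I x >].

Fact ideal_pred_closed I : submod_closed (ideal_pred I).
Proof.
have [I0 ID IM] := inv_ideal_submod I; split=> [|r x y /asboolP Ix /asboolP Iy].
  exact/asboolP.
by apply/asboolP/ID => //; apply: IM.
Qed.
HB.instance Definition _ I := GRing.isSubmodClosed.Build R frac_mod (ideal_pred I)
  (ideal_pred_closed I).

Definition ideal_mod (I : inv_ideal R) := {x : frac_mod | x \in ideal_pred I}.
HB.instance Definition _ I := SubChoice.on (ideal_mod I).
HB.instance Definition _ I := [SubChoice_isSubLmodule of ideal_mod I by <:].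

End FractionModule.

Section PicardClass.
Variable R : idomainType.
Local Notation K := {fraction R}.
Implicit Types I J : inv_ideal R.

Lemma prod_principalE (x : K) (J : set K) : is_submod J ->
  prod_ideal (principal_ideal x) J = [set x * y | y in J].
Proof.
move=> sJ; apply/seteqP; split.
  apply: prod_sub => [|_ y [r ->] Jy].
    have [J0 JD JM] := sJ; split; first by exists 0; rewrite ?mulr0.
      by move=> _ _ [a Ja <-] [b Jb <-]; exists (a + b); rewrite ?mulrDr //; apply: JD.
    by move=> r _ [a Ja <-]; exists (r%:F * a); rewrite 1?mulrCA //; apply: JM.
  by exists (r%:F * y); [case: sJ => _ _; apply | rewrite mulrCA mulrA].
by move=> _ [y Jy <-]; apply: prod_in => //; exists 1; rewrite rmorph1 mul1r.
Qed.

Lemma ideal_classP I J : ideal_class I = ideal_class J <->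
  exists2 x : K, x != 0 & I = [set x * y | y in J] :> set K.
Proof.
have E : ideal_class I = ideal_class J <-> I - J \in @is_principal R.
  rewrite Quotient.idealrBE; split => [e|/eqP//]; exact/eqP.
rewrite E; split=> [/asboolP[x xn e]|[x xn e]].
  by exists x => //; rewrite -[I](subrK J) inv_idealD e prod_principalE.
apply/asboolP; exists x => //.
have -> : I = InvIdeal (principal_invertible xn) + J.
  by apply: inv_ideal_inj; rewrite inv_idealD prod_principalE.
by rewrite addrK.
Qed.

Lemma ideal_class_surj (c : Pic R) : exists I, c = ideal_class I.
Proof. by exists (repr c); rewrite /ideal_class reprK. Qed.

Lemma ideal_classD I J : ideal_class (I + J) = ideal_class I + ideal_class J.
Proof. exact: raddfD. Qed.

Lemma ideal_modP I (x : ideal_mod I) : carrier I (val x).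
Proof. by apply/asboolP; exact: (valP x). Qed.

Lemma val_scale I (r : R) (x : ideal_mod I) : val (r *: x) = r%:F * (val x : K).
Proof. by []. Qed.

Lemma val_sum I (T : Type) (s : seq T) (F : T -> ideal_mod I) :
  val (\sum_(p <- s) F p) = \sum_(p <- s) (val (F p) : K).
Proof. by elim: s => [|p s IH]; rewrite ?big_nil // !big_cons -IH. Qed.

Definition mk I (x : K) : ideal_mod I := insubd (0 : ideal_mod I) (x : frac_mod R).

Lemma mkK I x : carrier I x -> val (mk I x) = x.
Proof. by move=> Ix; rewrite /mk insubdK //; apply/asboolP. Qed.

Lemma ideal_class_iso I J : ideal_class I = ideal_class J ->
  exists (f : {linear ideal_mod I -> ideal_mod J})
         (g : {linear ideal_mod J -> ideal_mod I}), cancel f g /\ cancel g f.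
Proof.
move=> /ideal_classP[x xn e].
pose f0 (y : ideal_mod I) := mk J (x^-1 * (val y : K)).
pose g0 (y : ideal_mod J) := mk I (x * (val y : K)).
have f0E y : val (f0 y) = x^-1 * (val y : K).
  rewrite mkK //; have := ideal_modP y; rewrite e => -[z Jz <-].
  by rewrite mulKf.
have g0E y : val (g0 y) = x * (val y : K).
  by rewrite mkK // e; exists (val y) => //; exact: ideal_modP.
have fl : linear f0.
  move=> a y z; apply: val_inj; rewrite f0E !linearP /= !f0E !frac_scaleE.
  by rewrite mulrDr mulrCA.
have gl : linear g0.
  move=> a y z; apply: val_inj; rewrite g0E !linearP /= !g0E !frac_scaleE.
  by rewrite mulrDr mulrCA.
pose f : {linear ideal_mod I -> ideal_mod J} :=
  HB.pack f0 (GRing.isLinear.Build _ _ _ _ f0 fl).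
pose g : {linear ideal_mod J -> ideal_mod I} :=
  HB.pack g0 (GRing.isLinear.Build _ _ _ _ g0 gl).
exists f, g; split=> y; apply: val_inj.
  by rewrite g0E f0E mulVKf.
by rewrite f0E g0E mulKf.
Qed.

Lemma inv_ideal_neq0 I : exists2 x : K, carrier I x & x != 0.
Proof.
have [_ [J _ e]] := inv_idealP I.
have : @unit_ideal R 1 by exists 1; rewrite rmorph1.
rewrite -e => -[s hs s1].
case: (pselect (exists2 p, p \in s & p.1 != 0)) => [[p /hs[? _] ?]|nex]; first by exists p.1.
have : (1 : K) != 0 by exact: oner_neq0.
rewrite s1 big_seq big1 ?eqxx // => p ps; case: (eqVneq p.1 0) => [->|pn]; first by rewrite mul0r.
by case: nex; exists p.
Qed.

Lemma ideal_iso_class I J (f : {linear ideal_mod I -> ideal_mod J})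
   (g : {linear ideal_mod J -> ideal_mod I}) : cancel f g -> cancel g f ->
  ideal_class I = ideal_class J.
Proof.
move=> fK gK; apply/ideal_classP.
have H (y z : ideal_mod J) : (val (g y) : K) * val z = val (g z) * (val y : K).
  have [a [b [bn ey]]] := fracP (val y); have [c [d [dn ez]]] := fracP (val z).
  have bF : b%:F != 0 :> K by rewrite tofrac_eq0.
  have dF : d%:F != 0 :> K by rewrite tofrac_eq0.
  have e : (b * c) *: y = (a * d) *: z.
    apply: val_inj; rewrite !linearZ /= !frac_scaleE !rmorphM.
    rewrite ey ez; rewrite mulrC -!mulrA mulKf //.
    by congr (_ * _); rewrite mulrC mulfVK.
  have /(congr1 (fun t => (val t : K))) := congr1 g e.
  rewrite !linearZ /= !frac_scaleE !rmorphM => e'.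
  rewrite ey ez; apply/eqP; rewrite !mulrA eqr_div //; apply/eqP.
  by rewrite mulrC [_ * c%:F]mulrC mulrA e' mulrC [a%:F * _]mulrC mulrA mulrAC.
have [z0 Jz0 z0n] := inv_ideal_neq0 J.
have Ez0 := mkK Jz0.
exists ((val (g (mk J z0)) : K) / z0).
  rewrite mulf_neq0 ?invr_eq0 //; apply/eqP => e0.
  have /(congr1 f) : g (mk J z0) = 0 by apply: val_inj.
  by rewrite gK linear0 => /(congr1 (fun t => (val t : K))); rewrite Ez0 => /eqP; rewrite (negPf z0n).
have H' (y : ideal_mod J) : (val (g (mk J z0)) : K) / z0 * (val y : K) = val (g y).
  by rewrite mulrAC H Ez0 mulfK.
apply/seteqP; split=> [x Ix|_ [y Jy <-]].
  exists (val (f (mk I x))); first exact: ideal_modP.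
  by rewrite H' fK mkK.
by rewrite -[y](mkK Jy) H'; exact: ideal_modP.
Qed.

End PicardClass.

Section ScalarExtension.
Variables (R R' : comNzRingType) (phi : {rmorphism R -> R'}).

Lemma scalar_extension_unique (M : lmodType R) (N N' : lmodType R') :
  is_scalar_extension phi M N -> is_scalar_extension phi M N' ->
  exists (f : {linear N -> N'}) (g : {linear N' -> N}), cancel f g /\ cancel g f.
Proof.
move=> [u hu] [u' hu'].
have [f [fu _]] := hu _ u'; have [g [gu _]] := hu' _ u.
exists f, g; split.
  have [w [_ wU]] := hu _ u.
  move=> x; have := wU (g \o f) _ x; rewrite /= => ->; last first.
    by move=> y /=; have := fu y; rewrite /= => ->; exact: gu.
  by have := wU idfun _ x; rewrite /= => <-.
have [w [_ wU]] := hu' _ u'.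
move=> x; have := wU (f \o g) _ x; rewrite /= => ->; last first.
  by move=> y /=; have := gu y; rewrite /= => ->; exact: fu.
by have := wU idfun _ x; rewrite /= => <-.
Qed.

Lemma scalar_extension_iso (M M' : lmodType R) (N : lmodType R')
    (f : {linear M -> M'}) (g : {linear M' -> M}) : cancel f g -> cancel g f ->
  is_scalar_extension phi M' N -> is_scalar_extension phi M N.
Proof.
move=> fK gK [u hu]; exists (u \o f) => P v.
have [w [wu wU]] := hu P (v \o g).
exists w; split=> [x|w' w'u x].
  by have := wu (f x); rewrite /= fK.
apply: wU => y; have := w'u (g y); by rewrite /= gK.
Qed.

Lemma scalar_extension_iso_r (M : lmodType R) (N N' : lmodType R')
    (f : {linear N -> N'}) (g : {linear N' -> N}) : cancel f g -> cancel g f ->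
  is_scalar_extension phi M N -> is_scalar_extension phi M N'.
Proof.
move=> fK gK [u hu].
have ul : linear_for (phi \; *:%R) (f \o u).
  by move=> a x y /=; rewrite linearP linearD (linearZ_LR f).
pose fu : {linear M -> N' | phi \; *:%R} :=
  HB.pack (f \o u) (GRing.isLinear.Build _ _ _ _ (f \o u) ul).
exists fu => P v.
have [w [wu wU]] := hu P v.
exists (w \o g); split=> [x|w' w'u x].
  by have := wu x; rewrite /= fK.
have h : (w' \o f) \o u =1 v by move=> y; exact: w'u.
by have := wU (w' \o f) h (g x); rewrite /= gK.
Qed.

End ScalarExtension.

Section ExtendedIdeal.
Variables (R R' : idomainType) (phi : {rmorphism R -> R'}).
Local Notation K := {fraction R}.
Local Notation K' := {fraction R'}.

Definition num (x : K) : R := xget 0 [set r | x = r%:F].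

Lemma numK (r : R) : num r%:F = r.
Proof.
rewrite /num; case: xgetP => [x _ /= /eqP|/(_ r)]; last by case.
by rewrite tofrac_eq => /eqP.
Qed.

(** [phi] need not be injective. Each class of [Pic R] contains an integral ideal
    that does not lie in [ker phi] (lemma [good_rep]); the ideal of [R'] generated
    by the image of such an ideal [I] is [I (x)_R R'] (lemma
    [good_scalar_extension]). *)
Definition ext_ideal (I : set K) : set K' :=
  [set z | exists2 s : seq (R' * R), forall p, p \in s -> I p.2%:F
         & z = \sum_(p <- s) (p.1 * phi p.2)%:F].

Lemma ext_in I r : I r%:F -> ext_ideal I (phi r)%:F.
Proof.
move=> Ir; exists [:: (1, r)]; last by rewrite big_seq1 mul1r.
by move=> p; rewrite inE => /eqP ->.
Qed.

Lemma ext_sub I (L : set K') : is_submod L ->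
  (forall r, I r%:F -> L (phi r)%:F) -> ext_ideal I `<=` L.
Proof.
move=> sL h z [s hs ->]; apply: submod_sum => // p /hs /h.
by rewrite rmorphM; case: sL => _ _; apply.
Qed.

Lemma ext_submod I : is_submod (ext_ideal I).
Proof.
split; first by exists [::]; rewrite ?big_nil.
- move=> x y [s hs ->] [t ht ->]; exists (s ++ t); last by rewrite big_cat.
  by move=> p; rewrite mem_cat => /orP[/hs|/ht].
- move=> r x [s hs ->]; exists [seq (r * p.1, p.2) | p <- s].
    by move=> p /mapP[q /hs ? ->].
  by rewrite big_map mulr_sumr; apply: eq_bigr => p _; rewrite -rmorphM mulrA.
Qed.
Hint Resolve ext_submod : core.

Lemma ext_integral I : integral (ext_ideal I).
Proof. by apply: ext_sub => // r _; exists (phi r). Qed.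

Lemma integral_fractional (S : idomainType) (L : set {fraction S}) :
  is_submod L -> integral L -> fractional L.
Proof.
by move=> sL iL; split=> //; exists 1; rewrite ?oner_neq0 // => x /iL[r ->];
  exists r; rewrite rmorph1 mul1r.
Qed.

Lemma colon_submod (S : idomainType) (L : set {fraction S}) (c : {fraction S}) :
  is_submod L -> is_submod [set x | L (x * c)].
Proof.
move=> [L0 LD LM]; split=> /=; first by rewrite mul0r.
- by move=> x y Lx Ly; rewrite mulrDl; apply: LD.
- by move=> r x Lx; rewrite -mulrA; apply: LM.
Qed.

Lemma ext_prod (I J : set K) : is_submod I -> is_submod J ->
  integral I -> integral J ->
  ext_ideal (prod_ideal I J) = prod_ideal (ext_ideal I) (ext_ideal J).
Proof.
move=> sI sJ iI iJ; apply/seteqP; split.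
  apply: ext_sub; first exact: prod_submod.
  move=> r [s hs er].
  have -> : r = \sum_(p <- s) num p.1 * num p.2.
    apply/eqP; rewrite -(tofrac_eq r) er rmorph_sum; apply/eqP/eq_big_seq => p /hs[/iI[a ->] /iJ[b ->]].
    by rewrite !numK rmorphM.
  rewrite !rmorph_sum; apply: submod_sum; first exact: prod_submod.
  move=> p /hs[Ip Jp]; rewrite !rmorphM; have [a ea] := iI _ Ip; have [b eb] := iJ _ Jp.
  by move: Ip Jp; rewrite ea eb !numK => Ip Jp; apply: prod_in; apply: ext_in.
apply: prod_sub => // x y Ix Jy.
apply: (ext_sub (colon_submod y (ext_submod (prod_ideal I J))) _ Ix) => r Ir /=.
rewrite mulrC.
apply: (ext_sub (colon_submod _ (ext_submod (prod_ideal I J))) _ Jy) => t Jt /=.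
by rewrite -!rmorphM; apply: ext_in; rewrite rmorphM mulrC; apply: prod_in.
Qed.

Lemma ext_principal (a : R) :
  ext_ideal (principal_ideal a%:F) = principal_ideal (phi a)%:F.
Proof.
apply/seteqP; split.
  apply: ext_sub => // r [b]; rewrite -rmorphM => /eqP; rewrite tofrac_eq => /eqP ->.
  by exists (phi b); rewrite -!rmorphM.
move=> _ [r ->]; have [_ _] := ext_submod (principal_ideal a%:F); apply.
by apply: ext_in; exists 1; rewrite rmorph1 mul1r.
Qed.

Definition good (I : set K) := integral I /\ exists2 a : R, I a%:F & phi a != 0.

Lemma good_ext_invertible (I : inv_ideal R) : good I -> invertible (ext_ideal I).
Proof.
move=> [iI [a Ia an]]; have [fI [J fJ e]] := inv_idealP I.
have sJ := fJ.1.
pose aJ := prod_ideal (principal_ideal a%:F) J.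
have saJ : is_submod aJ by exact: prod_submod.
have iaJ : integral aJ.
  rewrite /integral -e; apply: prod_sub; first exact: prod_submod.
  move=> _ y [r ->] Jy; apply: prod_in => //.
  by have [_ _] := inv_ideal_submod I; apply.
have e' : prod_ideal I aJ = principal_ideal a%:F.
  by rewrite /aJ [prod_ideal _ J]prodC prodA // e prod1.
apply: (@invertible_of_principal _ _ (ext_ideal aJ) (phi a)%:F).
- by rewrite tofrac_eq0.
- by apply: integral_fractional => //; exact: ext_integral.
- by apply: integral_fractional => //; exact: ext_integral.
- by rewrite -ext_prod // e' ext_principal.
Qed.

Lemma good_rep (I : inv_ideal R) :
  exists2 I' : inv_ideal R, good I' & ideal_class I' = ideal_class I.
Proof.
have [fI [J fJ e]] := inv_idealP I.
have : @unit_ideal R 1 by exists 1; rewrite rmorph1.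
rewrite -e => -[s hs s1].
have hR x y : carrier I x -> J y -> unit_ideal (x * y) by rewrite -e; exact: prod_in.
have [p ps pn] : exists2 p, p \in s & phi (num (p.1 * p.2)) != 0.
  case: (pselect (exists2 p, p \in s & phi (num (p.1 * p.2)) != 0)) => // nex.
  suff : (1 : R') != 1 by rewrite eqxx.
  have e1 : 1 = \sum_(p <- s) num (p.1 * p.2).
    apply/eqP; rewrite -(tofrac_eq 1) rmorph_sum rmorph1 s1; apply/eqP/eq_big_seq.
    by move=> p /hs[Ip Jp]; have [r ->] := hR _ _ Ip Jp; rewrite numK.
  have : 1 = \sum_(p <- s) phi (num (p.1 * p.2)) by rewrite -rmorph_sum -e1 rmorph1.
  rewrite big_seq big1 ?oner_neq0 // => [/eqP|p ps]; first by rewrite oner_eq0.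
  by case: (eqVneq (phi (num (p.1 * p.2))) 0) => // pn; case: nex; exists p.
have [Ip Jp] := hs p ps.
have p2n : p.2 != 0.
  by apply: contraNneq pn => ->; rewrite mulr0 -[0](rmorph0 (@FracField.tofrac R)) numK rmorph0.
exists (InvIdeal (principal_invertible p2n) + I).
  split=> [|]; rewrite inv_idealD /= prod_principalE //.
    by move=> _ [x Ix <-]; rewrite mulrC; apply: hR.
  have [r er] := hR _ _ Ip Jp.
  exists r; last by move: pn; rewrite er numK.
  by exists p.1; rewrite // -er mulrC.
apply/ideal_classP; exists p.2 => //; by rewrite inv_idealD /= prod_principalE.
Qed.

Lemma goodD (I J : inv_ideal R) : good I -> good J -> good (I + J : inv_ideal R).
Proof.
move=> [iI [a Ia an]] [iJ [b Jb bn]]; rewrite inv_idealD; split.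
  apply: prod_sub => // x y /iI[r ->] /iJ[t ->].
  by exists (r * t); rewrite rmorphM.
by exists (a * b); rewrite rmorphM ?mulf_neq0 //; apply: prod_in.
Qed.

Definition ext_inv_ideal (I : inv_ideal R) (hI : good I) : inv_ideal R' :=
  InvIdeal (good_ext_invertible hI).

Lemma good_scalar_extension (I : inv_ideal R) (hI : good I) :
  is_scalar_extension phi (ideal_mod I) (ideal_mod (ext_inv_ideal hI)).
Proof.
set E := ext_inv_ideal hI.
have [iI [a Ia an]] := hI.
have [_ [J fJ e]] := inv_idealP I.
have : @unit_ideal R 1 by exists 1; rewrite rmorph1.
rewrite -e => -[s hs s1].
have hR x y : carrier I x -> J y -> unit_ideal (x * y) by rewrite -e; exact: prod_in.
have valI (x : ideal_mod I) : exists r : R, (val x : K) = r%:F.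
  by apply: iI; exact: ideal_modP.
have aF : (phi a)%:F != 0 :> K' by rewrite tofrac_eq0.
pose u0 (x : ideal_mod I) := mk E (phi (num (val x : K)))%:F.
have u0E x : val (u0 x) = (phi (num (val x : K)))%:F.
  rewrite mkK //; have [r er] := valI x; rewrite er numK; apply: ext_in.
  by rewrite -er; exact: ideal_modP.
have ul : linear_for (phi \; *:%R) u0.
  move=> r x y; have [b eb] := valI x; have [c ec] := valI y.
  have e1 : (val (r *: x + y) : K) = (r * b + c)%:F.
    transitivity (r%:F * (val x : K) + val y) => //.
    by rewrite eb ec rmorphD rmorphM.
  apply: val_inj; rewrite u0E e1.
  transitivity ((phi r)%:F * (val (u0 x) : K') + val (u0 y)) => //.
  by rewrite !u0E eb ec !numK !(rmorphD, rmorphM).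
pose u : {linear ideal_mod I -> ideal_mod E | phi \; *:%R} :=
  HB.pack u0 (GRing.isLinear.Build _ _ _ _ u0 ul).
exists u => P v.
pose b (p : K * K) := num (a%:F * p.2).
pose co (z : K') p := z * ((phi (b p))%:F / (phi a)%:F).
have coR z p : p \in s -> ext_ideal I z -> unit_ideal (co z p).
  move=> /hs[Ip Jp] Iz.
  suff h r : carrier I r%:F -> unit_ideal ((phi r)%:F * ((phi (b p))%:F / (phi a)%:F)).
    by have := @ext_sub (carrier I) _ (colon_submod ((phi (b p))%:F / (phi a)%:F) (@unit_submod R')) h z Iz.
  move=> Ir.
  have [t et] := hR _ _ Ir Jp; have [c ec] := hR _ _ Ia Jp.
  exists (phi t); rewrite /b ec numK mulrA -rmorphM -rmorphM.
  have -> : r * c = a * t.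
    by apply/eqP; rewrite -tofrac_eq !tofracM -et -ec mulrCA.
  by rewrite !rmorphM mulrC mulKf.
pose num' (x : K') : R' := xget 0 [set r | x = r%:F].
have num'K r : num' r%:F = r.
  rewrite /num'; case: xgetP => [x _ /= /eqP|/(_ r)]; last by case.
  by rewrite tofrac_eq => /eqP.
pose w0 (z : ideal_mod E) : P := \sum_(p <- s) num' (co (val z) p) *: v (mk I p.1).
have wl : linear w0.
  move=> r y z; rewrite /w0 scaler_sumr -big_split /=; apply: eq_big_seq => p ps.
  rewrite scalerA -scalerDl; congr (_ *: _).
  have -> : co (val (r *: y + z)) p = r%:F * co (val y) p + co (val z) p.
    transitivity (co (r%:F * (val y : K') + val z) p) => //.
    by rewrite /co mulrDl -mulrA.
  have [? ->] := coR _ _ ps (ideal_modP y); have [? ->] := coR _ _ ps (ideal_modP z).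
  by rewrite -rmorphM -rmorphD !num'K.
pose w : {linear ideal_mod E -> P} := HB.pack w0 (GRing.isLinear.Build _ _ _ _ w0 wl).
have wu : w \o u =1 v.
  move=> x; have [r er] := valI x.
  have Ir : carrier I r%:F by rewrite -er; exact: ideal_modP.
  have xE : x = \sum_(p <- s) num (p.2 * r%:F) *: mk I p.1.
    apply: val_inj; rewrite er val_sum.
    rewrite -[LHS]mul1r s1 mulr_suml; apply: eq_big_seq => p ps.
    have [Ip Jp] := hs p ps; rewrite val_scale mkK //.
    have [t et] := hR _ _ Ir Jp.
    have e2 : p.2 * r%:F = t%:F by rewrite mulrC.
    by rewrite e2 numK -e2 -mulrA mulrC.
  transitivity (\sum_(p <- s) phi (num (p.2 * r%:F)) *: v (mk I p.1)); last first.
    rewrite [in RHS]xE [RHS]raddf_sum; apply: eq_bigr => p _.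
    by symmetry; exact: (linearZ_LR v).
  transitivity (w0 (u0 x)) => //; apply: eq_big_seq => p ps; congr (_ *: _).
  have [Ip Jp] := hs p ps.
  rewrite u0E er numK /co.
  have [t et] := hR _ _ Ir Jp; have [c ec] := hR _ _ Ia Jp.
  rewrite /b ec [p.2 * _]mulrC et !numK mulrA -rmorphM -rmorphM.
  have -> : r * c = a * t.
    by apply/eqP; rewrite -tofrac_eq !tofracM -et -ec mulrCA.
  by rewrite !rmorphM mulrC mulKf // num'K.
exists w; split=> // w' w'u z.
have zE : exists2 t : seq (R' * ideal_mod I), True & z = \sum_(p <- t) p.1 *: u p.2.
  have [t ht et] := ideal_modP z.
  exists [seq (p.1, mk I p.2%:F) | p <- t] => //.
  apply: val_inj; rewrite val_sum et big_map; apply: eq_big_seq => p /ht Ip.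
  by rewrite val_scale u0E mkK // numK rmorphM.
have [t _ ->] := zE; rewrite !raddf_sum /=; apply: eq_bigr => p _.
have e2 : w' (u p.2) = w (u p.2) := etrans (w'u p.2) (esym (wu p.2)).
transitivity (p.1 *: w' (u p.2)); first exact: (linearZ_LR w').
by rewrite e2; symmetry; exact: (linearZ_LR w).
Qed.

Lemma Pic_map_ex (c : Pic R) : exists c' : Pic R',
  exists I J, [/\ c = ideal_class I, c' = ideal_class J
                & is_scalar_extension phi (ideal_mod I) (ideal_mod J)].
Proof.
have [I ->] := ideal_class_surj c; have [I' gI' <-] := good_rep I.
exists (ideal_class (ext_inv_ideal gI')), I', (ext_inv_ideal gI'); split => //.
exact: good_scalar_extension.
Qed.

(** [[I] |-> [I (x)_R R']]; see [Pic_mapP]. *)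
Definition Pic_map (c : Pic R) : Pic R' := projT1 (cid (Pic_map_ex c)).

Lemma Pic_mapP (I : inv_ideal R) (J : inv_ideal R') :
  Pic_map (ideal_class I) = ideal_class J <->
  is_scalar_extension phi (ideal_mod I) (ideal_mod J).
Proof.
rewrite /Pic_map; case: cid => c' /= [I0 [J0 [eI -> h0]]].
have [f [g [fK gK]]] := ideal_class_iso eI.
have h1 := scalar_extension_iso fK gK h0; split=> [e|h2].
  have [f' [g' [fK' gK']]] := ideal_class_iso e.
  exact: scalar_extension_iso_r fK' gK' h1.
have [f' [g' [fK' gK']]] := scalar_extension_unique h1 h2.
exact: ideal_iso_class fK' gK'.
Qed.

Lemma Pic_mapE (I : inv_ideal R) (hI : good I) :
  Pic_map (ideal_class I) = ideal_class (ext_inv_ideal hI).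
Proof. by apply/Pic_mapP; exact: good_scalar_extension. Qed.

Lemma Pic_map_is_additive : zmod_morphism Pic_map.
Proof.
have D c d : Pic_map (c + d) = Pic_map c + Pic_map d.
  have [I ->] := ideal_class_surj c; have [I' gI' <-] := good_rep I.
  have [J ->] := ideal_class_surj d; have [J' gJ' <-] := good_rep J.
  rewrite -ideal_classD (Pic_mapE (goodD gI' gJ')) !Pic_mapE -ideal_classD.
  congr ideal_class; apply: inv_ideal_inj => /=.
  by rewrite ext_prod //; [case: gI' | case: gJ'].
by move=> c d; apply/eqP; rewrite eq_sym subr_eq -D subrK.
Qed.
HB.instance Definition _ := GRing.isZmodMorphism.Build _ _ Pic_map Pic_map_is_additive.

End ExtendedIdeal.

(** The structure map of such an algebra is [in_alg : D -> A], which need not be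
    injective. *)
#[short(type="idomAlgType")]
HB.structure Definition IdomAlgebra (D : nzRingType) :=
  {A of GRing.IntegralDomain A & GRing.ComUnitAlgebra D A}.

Record idomExt (D : idomainType) := IdomExt {
  idomExt_alg :> idomAlgType D;
  idomExt_inj : injective (GRing.in_alg idomExt_alg) }.

Section LocalPicard.
Variables (D : idomainType) (R : idomAlgType D).

Definition Pic_iota : Pic D -> Pic R := Pic_map (GRing.in_alg R).
HB.instance Definition _ := GRing.Additive.on Pic_iota.

Definition iota_image : {pred Pic R} := fun c => `[< exists d, c = Pic_iota d >].

Fact iota_image_closed : zmod_closed iota_image.
Proof.
split=> [|_ _ /asboolP[c ->] /asboolP[d ->]]; apply/asboolP.
  by exists 0; rewrite raddf0.
by exists (c - d); rewrite raddfB.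
Qed.
HB.instance Definition _ := GRing.isZmodClosed.Build (Pic R) iota_image
  iota_image_closed.

Definition LPic := Quotient.quot iota_image.
HB.instance Definition _ := GRing.Zmodule.on LPic.

Definition LPic_class (c : Pic R) : LPic := \pi_LPic c.

End LocalPicard.

Arguments iota_image {D} R _.

Section UnitaryPicard.
Variables (D : idomainType) (R : idomExt D).

(** The quotient field of [D] is viewed inside that of [R] as the set of the
    fractions [a / b] with [a], [b] in [D]. *)
Definition unitary (I : set {fraction R}) :=
  exists x : {fraction R}, [/\ I x, x != 0 &
    exists a b : D, b != 0 /\ x = (a%:A : R)%:F / (b%:A : R)%:F].

(** The intersection of all subgroups containing the classes of the invertible
    ideals that are integral and unitary. *)
Definition in_Pic_u : {pred Pic R} := fun c =>
  `[< forall H : {pred Pic R}, zmod_closed H ->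
      (forall I : inv_ideal R, integral I -> unitary I -> ideal_class I \in H) ->
      c \in H >].

Fact in_Pic_u_closed : zmod_closed in_Pic_u.
Proof.
split=> [|c d /asboolP hc /asboolP hd]; apply/asboolP => H cH hH.
  by case: cH.
by case: (cH) => _; apply; [apply: hc | apply: hd].
Qed.
HB.instance Definition _ := GRing.isZmodClosed.Build (Pic R) in_Pic_u
  in_Pic_u_closed.

Definition Pic_u := {c : Pic R | c \in in_Pic_u}.
HB.instance Definition _ := SubChoice.on Pic_u.
HB.instance Definition _ := [SubChoice_isSubZmodule of Pic_u by <:].

Lemma iota_image_sub : {subset iota_image R <= in_Pic_u}.
Proof.
move=> _ /asboolP[d ->]; have [I0 ->] := ideal_class_surj d.
have [I gI <-] := good_rep (GRing.in_alg R) I0.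
rewrite /Pic_iota (Pic_mapE gI); apply/asboolP => H _; apply.
  exact: ext_integral.
have [_ [a Ia an]] := gI.
exists (GRing.in_alg R a)%:F; split; [exact: ext_in | by rewrite tofrac_eq0 |].
by exists a, 1; split; rewrite ?oner_neq0 // scale1r rmorph1 divr1.
Qed.

Definition iota_image_u : {pred Pic_u} := fun c => val c \in iota_image R.

Fact iota_image_u_closed : zmod_closed iota_image_u.
Proof.
split=> [|c d hc hd]; rewrite unfold_in /=; first exact: rpred0.
exact: (rpredB hc hd).
Qed.
HB.instance Definition _ := GRing.isZmodClosed.Build Pic_u iota_image_u
  iota_image_u_closed.

(** By [iota_image_sub], [iota_image_u] is all of [iota (Pic D)], viewed in [Pic_u]. *)
Definition LPic_u := Quotient.quot iota_image_u.
HB.instance Definition _ := GRing.Zmodule.on LPic_u.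

Definition LPic_u_class (c : Pic_u) : LPic_u := \pi_LPic_u c.

End UnitaryPicard.

Record category := Category {
  obj :> Type;
  hom : obj -> obj -> Type;
  idhom : forall A, hom A A;
  comphom : forall A B C, hom B C -> hom A B -> hom A C;
  comphomA : forall A B C E (h : hom C E) (g : hom B C) (f : hom A B),
    comphom h (comphom g f) = comphom (comphom h g) f;
  comp1hom : forall A B (f : hom A B), comphom (idhom B) f = f;
  comphom1 : forall A B (f : hom A B), comphom f (idhom A) = f }.

Arguments hom {c} : rename.
Arguments idhom {c} A : rename.
Arguments comphom {c A B C} : rename.

(** Functors with a prescribed action on objects. *)
Record functor (C C' : category) (F : C -> C') := Functor {
  fmap : forall A B : C, hom A B -> hom (F A) (F B);
  fmap_id : forall A, fmap (idhom A) = idhom (F A);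
  fmap_comp : forall A B E (g : hom B E) (f : hom A B),
    fmap (comphom g f) = comphom (fmap g) (fmap f) }.

Arguments fmap {C C' F} f {A B} : rename.

Lemma additive_eq (U V : zmodType) (f g : {additive U -> V}) : f =1 g -> f = g.
Proof.
case: f => f [[pf]]; case: g => g [[pg]] /= /funext e.
by subst g; rewrite (Prop_irrelevance pf pg).
Qed.

Lemma lrmorphism_eq (D : nzRingType) (A B : idomAlgType D)
  (f g : {lrmorphism A -> B}) : f =1 g -> f = g.
Proof.
case: f => f [[pf] [qf] [rf]]; case: g => g [[pg] [qg] [rg]] /= /funext e.
subst g; rewrite (Prop_irrelevance pf pg) (Prop_irrelevance qf qg).
by rewrite (Prop_irrelevance rf rg).
Qed.

Definition Ab : category.
Proof.
apply: (@Category zmodType (fun U V => {additive U -> V}) (fun U => idfun)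
  (fun U V W g f => g \o f)) => *; exact: additive_eq.
Defined.

Definition idomAlg_cat (D : idomainType) : category.
Proof.
apply: (@Category (idomAlgType D) (fun A B => {lrmorphism A -> B}) (fun A => idfun)
  (fun A B C g f => g \o f)) => *; exact: lrmorphism_eq.
Defined.

Definition idomExt_cat (D : idomainType) : category.
Proof.
apply: (@Category (idomExt D) (fun A B => {lrmorphism A -> B}) (fun A => idfun)
  (fun A B C g f => g \o f)) => *; exact: lrmorphism_eq.
Defined.

(* Main.v *)
(** Every class of [Pic R] is represented by an integral ideal containing some [a]
    with [phi a != 0], and on such ideals [Pic_map phi] is extension of ideals; so
    it is functorial, and being over [D] it respects the images of [Pic D]. If [I] is
    integral and contains a nonzero fraction [a / b] of elements of [D], then it
    contains [a] itself, whose image in an extension of [D] is nonzero. Hence [I] can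
    be extended directly, and the extended ideal, integral and containing [a], is
    again unitary: this gives the restriction to [Pic_u]. *)

Require Import Defs.
From HB Require Import structures.
From mathcomp Require Import all_boot all_order all_algebra.
From mathcomp Require Import boolp classical_sets.
Set Implicit Arguments.
Unset Strict Implicit.
Unset Printing Implicit Defensive.
Import GRing.Theory.
Local Open Scope ring_scope.

(** [LPic] and [LPic_u] are both quotients of this kind, so one factorization serves both
    functors. *)
Lemma quot_factor (U V : zmodType) (A : zmodClosed U) (B : zmodClosed V)
    (f : {additive U -> V}) : {homo f : x / x \in A >-> x \in B} ->
  exists g : {additive Quotient.quot A -> Quotient.quot B},
    forall x, g (\pi_(Quotient.quot A)%qT x) = \pi_(Quotient.quot B)%qT (f x).
Proof.
move=> fAB.
pose g0 (c : Quotient.quot A) : Quotient.quot B := \pi_(Quotient.quot B)%qT (f (repr c)).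
have g0E x : g0 (\pi_(Quotient.quot A)%qT x) = \pi_(Quotient.quot B)%qT (f x).
  (* The chosen representative of the class of [x] differs from [x] by an element of [A], which [f]
     sends into [B]. *)
  apply/eqP; rewrite -Quotient.idealrBE -raddfB; apply: fAB.
  by rewrite Quotient.idealrBE reprK.
have gB : zmod_morphism g0.
  move=> c d; rewrite -[c]reprK -[d]reprK -raddfB !g0E raddfB.
  exact: raddfB.
pose g : {additive Quotient.quot A -> Quotient.quot B} :=
  HB.pack g0 (GRing.isZmodMorphism.Build _ _ g0 gB).
by exists g.
Qed.

Lemma ext_ideal_comp (R S T : idomainType) (phi : {rmorphism R -> S})
    (psi : {rmorphism S -> T}) (chi : {rmorphism R -> T}) (I : set {fraction R}) :
  chi =1 psi \o phi -> ext_ideal psi (ext_ideal phi I) = ext_ideal chi I.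
Proof.
move=> chiE; have chi_in r : I r%:F -> ext_ideal psi (ext_ideal phi I) (chi r)%:F.
  by move=> Ir; rewrite chiE; do 2!apply: ext_in.
apply/seteqP; split; last exact: ext_sub (ext_submod _ _) chi_in.
apply: ext_sub => [|s [t ht /eqP]]; first exact: ext_submod.
(* Injectivity of [tofrac] moves the equation from fractions down to [S], where [psi] applies. *)
rewrite -rmorph_sum tofrac_eq => /eqP ->; rewrite !rmorph_sum.
apply: submod_sum => [|p /ht Ip]; first exact: ext_submod.
rewrite !rmorphM; have [_ _] := ext_submod chi I; apply.
by have := ext_in chi Ip; rewrite chiE.
Qed.

(** The composite is a separate [chi], known only pointwise, so that the structure map of an algebra
    can be taken for it. *)
Lemma Pic_map_comp (R S T : idomainType) (phi : {rmorphism R -> S})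
    (psi : {rmorphism S -> T}) (chi : {rmorphism R -> T}) :
  chi =1 psi \o phi -> Pic_map chi =1 Pic_map psi \o Pic_map phi.
Proof.
(* The representative must be good for [chi]: one good only for [phi] could extend to an ideal
   inside the kernel of [psi]. *)
move=> chiE c; have [I0 ->] := ideal_class_surj c; have [I gI <-] := good_rep chi I0.
have [iI [a Ia an]] := gI; rewrite chiE /= in an.
have gI_phi : good phi I.
  by split=> //; exists a => //; apply: contraNneq an => ->; rewrite rmorph0.
have gE : good psi (ext_inv_ideal gI_phi).
  by split; [exact: ext_integral | exists (phi a) => //; exact: ext_in].
rewrite /= (Pic_mapE gI) (Pic_mapE gI_phi) (Pic_mapE gE); congr ideal_class.
by apply: inv_ideal_inj; rewrite /= (ext_ideal_comp _ chiE).
Qed.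

Lemma Pic_map_id (R : idomainType) (phi : {rmorphism R -> R}) :
  phi =1 id -> Pic_map phi =1 id.
Proof.
move=> phiE c; have [I0 ->] := ideal_class_surj c; have [I gI <-] := good_rep phi I0.
rewrite (Pic_mapE gI); congr ideal_class; apply: inv_ideal_inj => /=.
have [iI _] := gI; apply/seteqP; split=> [|x Ix].
  by apply: ext_sub => // r; rewrite phiE.
(* Extension only sees the elements of [I] lying in [R]; by integrality these are all of them. *)
by have [r er] := iI x Ix; rewrite er -[r]phiE; apply: ext_in; rewrite -er.
Qed.

Section LocalPicardFunctors.
Variable D : idomainType.

(** The structure map of [S] is that of [R] followed by [phi], so the same class [d] of [Pic D]
    serves on both sides. *)
Lemma Pic_map_iota_image (R S : idomAlgType D) (phi : {lrmorphism R -> S}) :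
  {homo Pic_map phi : c / c \in iota_image R >-> c \in iota_image S}.
Proof.
move=> _ /asboolP[d ->]; apply/asboolP; exists d.
rewrite /Pic_iota; symmetry; apply: (@Pic_map_comp D R S) => x /=.
by rewrite linearZ /= rmorph1.
Qed.

Definition LPic_map (R S : idomAlgType D) (phi : {lrmorphism R -> S}) :
    {additive LPic R -> LPic S} :=
  projT1 (cid (quot_factor (f := Pic_map phi) (@Pic_map_iota_image R S phi))).

Lemma LPic_mapE (R S : idomAlgType D) (phi : {lrmorphism R -> S}) (c : Pic R) :
  LPic_map phi (LPic_class c) = LPic_class (Pic_map phi c).
Proof. rewrite /LPic_map; case: cid => g gE; exact: gE. Qed.

Lemma LPic_class_surj (R : idomAlgType D) (c : LPic R) : exists d, c = LPic_class d.
Proof. by exists (repr c); rewrite /LPic_class reprK. Qed.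

(** Kept transparent so that [fmap] reduces to [LPic_map]; the laws are checked on classes, where
    they are those of [Pic_map]. *)
Definition LPic_functor : functor (C := idomAlg_cat D) (C' := Ab)
  (fun R : idomAlgType D => LPic R : zmodType).
Proof.
apply: (@Functor (idomAlg_cat D) Ab _ LPic_map) => [R|R S T psi phi];
  apply: additive_eq => c; have [d ->] := LPic_class_surj c.
  by rewrite LPic_mapE Pic_map_id.
rewrite LPic_mapE /= !LPic_mapE; congr LPic_class.
exact: Pic_map_comp.
Defined.

Lemma idomExt_alg_neq0 (R : idomExt D) (a : D) : a != 0 -> (a%:A : R) != 0.
Proof.
by apply: contra => /eqP e; apply/eqP/(@idomExt_inj D R); rewrite /= e scale0r.
Qed.

Lemma Pic_map_in_Pic_u (R S : idomExt D) (phi : {lrmorphism R -> S}) :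
  {homo Pic_map phi : c / c \in @in_Pic_u D R >-> c \in @in_Pic_u D S}.
Proof.
move=> c /asboolP hc; apply/asboolP => H cH hH.
(* The preimage of the subgroup [H] is a subgroup, so it is enough that it contains the generators
   of [Pic_u R]. *)
pose H' : {pred Pic R} := fun c => Pic_map phi c \in H.
have [H0 HB] := cH.
apply: (hc H') => [|I iI [x [Ix xn [a [b [bn ex]]]]]].
  split=> [|d e hd he]; rewrite unfold_in /H' ?raddf0 //.
  by rewrite raddfB; apply: HB.
have b0 : (b%:A : R) != 0 by exact: idomExt_alg_neq0.
have bF : (b%:A : R)%:F != 0 :> {fraction R} by rewrite tofrac_eq0.
have an : a != 0.
  by apply: contraNneq xn => a0; rewrite ex a0 scale0r rmorph0 mul0r.
have Ia : carrier I (a%:A : R)%:F.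
  have -> : (a%:A : R)%:F = (b%:A : R)%:F * x by rewrite ex mulrC mulfVK.
  by have [_ _] := inv_ideal_submod I; apply.
(* [phi] may have a kernel, but it respects the images of [D], and [D] embeds in [S]; hence [a] is
   not killed. *)
have phia : phi a%:A = a%:A by rewrite linearZ /= rmorph1.
have aS : (a%:A : S) != 0 by exact: idomExt_alg_neq0.
have gI : good phi I by split=> //; exists (a%:A : R) => //; move: aS; rewrite -phia.
rewrite unfold_in /H' (Pic_mapE gI); apply: hH => /=; first exact: ext_integral.
exists (a%:A : S)%:F; split; [|by rewrite tofrac_eq0|].
  by rewrite -phia; exact: ext_in.
by exists a, 1; split; rewrite ?oner_neq0 // scale1r rmorph1 divr1.
Qed.

Lemma Pic_u_map_ex (R S : idomExt D) (phi : {lrmorphism R -> S}) :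
  exists f : {additive Pic_u R -> Pic_u S}, forall c, val (f c) = Pic_map phi (val c).
Proof.
pose f0 (c : Pic_u R) : Pic_u S := Sub (Pic_map phi (val c)) (Pic_map_in_Pic_u phi (valP c)).
have f0E c : val (f0 c) = Pic_map phi (val c) by rewrite SubK.
have fB : zmod_morphism f0 by move=> c d; apply: val_inj; rewrite raddfB !f0E !raddfB.
pose f : {additive Pic_u R -> Pic_u S} :=
  HB.pack f0 (GRing.isZmodMorphism.Build _ _ f0 fB).
by exists f.
Qed.

Definition Pic_u_map (R S : idomExt D) (phi : {lrmorphism R -> S}) :
  {additive Pic_u R -> Pic_u S} := projT1 (cid (Pic_u_map_ex phi)).

Lemma val_Pic_u_map (R S : idomExt D) (phi : {lrmorphism R -> S}) (c : Pic_u R) :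
  val (Pic_u_map phi c) = Pic_map phi (val c).
Proof. by rewrite /Pic_u_map; case: cid. Qed.

Lemma Pic_u_map_iota_image (R S : idomExt D) (phi : {lrmorphism R -> S}) :
  {homo Pic_u_map phi : c / c \in @iota_image_u D R >-> c \in @iota_image_u D S}.
Proof.
move=> c hc; rewrite unfold_in /iota_image_u val_Pic_u_map.
exact: Pic_map_iota_image.
Qed.

Definition LPic_u_map (R S : idomExt D) (phi : {lrmorphism R -> S}) :
    {additive LPic_u R -> LPic_u S} :=
  projT1 (cid (quot_factor (@Pic_u_map_iota_image R S phi))).

Lemma LPic_u_mapE (R S : idomExt D) (phi : {lrmorphism R -> S}) (c : Pic_u R) :
  LPic_u_map phi (LPic_u_class c) = LPic_u_class (Pic_u_map phi c).
Proof. rewrite /LPic_u_map; case: cid => g gE; exact: gE. Qed.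

Lemma LPic_u_class_surj (R : idomExt D) (c : LPic_u R) :
  exists d, c = LPic_u_class d.
Proof. by exists (repr c); rewrite /LPic_u_class reprK. Qed.

(** Injectivity of [val] reduces both laws to those of [Pic_map] on the underlying classes. *)
Definition LPic_u_functor : functor (C := idomExt_cat D) (C' := Ab)
  (fun R : idomExt D => LPic_u R : zmodType).
Proof.
apply: (@Functor (idomExt_cat D) Ab _ LPic_u_map) => [R|R S T psi phi];
  apply: additive_eq => c; have [d ->] := LPic_u_class_surj c.
  rewrite LPic_u_mapE; congr LPic_u_class; apply: val_inj.
  by rewrite val_Pic_u_map Pic_map_id.
rewrite LPic_u_mapE /= !LPic_u_mapE; congr LPic_u_class; apply: val_inj.
by rewrite !val_Pic_u_map; exact: Pic_map_comp.
Defined.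

End LocalPicardFunctors.

Theorem proposition6p4 (D : idomainType)
    (D_not_field : exists2 d : D, d != 0 & d \isn't a GRing.unit) :
  (exists F : functor (C := idomAlg_cat D) (C' := Ab)
                      (fun R : idomAlgType D => LPic R : zmodType),
     forall (R R' : idomAlgType D) (phi : {lrmorphism R -> R'}) (c : Pic R),
       (fmap F phi : {additive LPic R -> LPic R'}) (LPic_class c) =
       LPic_class (Pic_map phi c)) /\
  (exists Fu : functor (C := idomExt_cat D) (C' := Ab)
                       (fun R : idomExt D => LPic_u R : zmodType),
     forall (R R' : idomExt D) (phi : {lrmorphism R -> R'}) (c : Pic_u R),
       exists2 c' : Pic_u R', val c' = Pic_map phi (val c) &
         (fmap Fu phi : {additive LPic_u R -> LPic_u R'}) (LPic_u_class c) =
         LPic_u_class c').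
Proof.
split; first by exists (LPic_functor D) => R R' phi c; exact: LPic_mapE.
exists (LPic_u_functor D) => R R' phi c.
by exists (Pic_u_map phi c); [exact: val_Pic_u_map | exact: LPic_u_mapE].
Qed.
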